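(* Let $n$ be a natural number. Let $L$ be any $n$-colorable link with non-zero determinant, $\det L \neq 0$, and let $C^*_n(L)$ be the minimal number of colors on effectively $n$-colored diagrams of $L$, that is, the minimum of the cardinality $|\operatorname{Im}\gamma|$ over all pairs $(D,\gamma)$ where $D$ is a diagram of $L$ and $\gamma$ is an effective $n$-coloring on $D$. Then $$C^*_n(L) \geq 1+\log_2 n .$$
   Context: Natural numbers are positive integers. Links are links in $S^3$ (classical links, knots included), and a diagram of a link is a regular diagram. The arcs of a diagram are the usual ones: the diagram is cut at each under-crossing, so that at each crossing there is one over arc and two under arcs (these need not be distinct). **$n$-colorings.** Let $D$ be a diagram of a link $L$ and $n$ a natural number. A map $\gamma:\{\text{arcs of } D\}\to\mathbb{Z}$ is called an $n$-coloring on $D$ if at each crossing of $D$, with over arc $a$ and under arcs $b$ and $c$, one has $$2\gamma(a)\equiv\gamma(b)+\gamma(c) \pmod n.$$ An $n$-coloring assigning the same color to all arcs of the diagram is called trivial. The link $L$ is called $n$-colorable if some diagram of $L$ admits a non-trivial $n$-coloring. The number of colors of $\gamma$ is the cardinality of the image of $\gamma$ (as a subset of $\mathbb{Z}$). **Effective $n$-colorings.** Let $n=p_1^{e_1}\cdots p_s^{e_s}$ be the prime decomposition of $n$, with primes $p_1,\dots,p_s$. A vector $\boldsymbol{x}=(x_1,\dots,x_k)\in\mathbb{Z}^k$ is $p_i$-trivial if $x_1\equiv\cdots\equiv x_k\pmod{p_i}$. If $\boldsymbol{x}$ is not $p_i$-trivial for any $p_i$ (i.e. for every $i=1,\dots,s$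 it fails to be $p_i$-trivial), then $\boldsymbol{x}$ is called $n$-effective. If $\gamma$ is an $n$-coloring on a diagram $D$ with arcs $\alpha_1,\dots,\alpha_k$ and $x_j=\gamma(\alpha_j)$, then $\gamma$ is called an effective $n$-coloring if $\gamma$ is non-trivial and $(x_1,\dots,x_k)$ is $n$-effective. An effectively $n$-colored diagram of $L$ is a diagram of $L$ together with an effective $n$-coloring on it. If $L$ has no effectively $n$-colored diagram, the minimum $C^*_n(L)$ is over an empty set and the inequality is understood to hold vacuously; so the assertion is that every effective $n$-coloring of every diagram of $L$ uses at least $1+\log_2 n$ distinct colors. **Determinant.** Regard the arcs of a diagram $D$ of $L$ as variables and associate to each crossing the expression ''twice the over arc minus the sum of the two under arcs''. The integer coefficient matrix of the resulting linear system (rows indexed by crossings, columns by arcs) is the coloring matrix of $D$. The absolute value of a first minor of the coloring matrix (the determinant of the matrix obtained by deleting one row and one column) is an invariant of $L$, and it is the determinant $\det L$ of the link (the standard link determinant). *)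

(* Defs.v *)
From HB Require Import structures.
From Stdlib Require Import Relation_Operators.
From mathcomp Require Import all_boot all_order all_algebra.
From mathcomp Require Import all_classical all_reals all_analysis.

Set Implicit Arguments.
Unset Strict Implicit.
Unset Printing Implicit Defensive.

Import Order.TTheory GRing.Theory Num.Theory.

Local Open Scope classical_set_scope.
Local Open Scope ring_scope.

(** * Link diagrams

   Diagrams are given by planar diagram (PD) codes. Every edge of the diagram,
   seen as a 4-valent graph on the sphere, carries a label, and a crossing is
   the tuple of the labels of its four half-edges, listed counterclockwise
   starting from one end of the under-strand: in [tuple a; b; c; d] the under-strand
   runs from a to c and the over-strand from b to d. A joint [tuple a; b] is a
   marked point on a strand, between the edges a and b. Joints are part of no
   crossing; they allow for closed components without crossings (such as the
   standard unknot, which is the single joint [tuple 0; 0]) and make the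
   Reidemeister moves local replacements in the list of vertices. *)
Record pd_code := PD {
  crossings : seq (4.-tuple nat);
  joints : seq (2.-tuple nat) }.

Definition labels (D : pd_code) : seq nat :=
  flatten (map val (crossings D)) ++ flatten (map val (joints D)).

Definition closed_code (D : pd_code) : bool :=
  all (fun a => count_mem a (labels D) == 2%N) (labels D).

Definition crossing (D : pd_code) := 'I_(size (crossings D)).
Definition joint (D : pd_code) := 'I_(size (joints D)).

(* The darts are the half-edges. *)
Definition dart (D : pd_code) : finType :=
  (crossing D * 'I_4 + joint D * 'I_2)%type.

Definition label (D : pd_code) (x : dart D) : nat :=
  match x with
  | inl (i, k) => tnth (tnth (in_tuple (crossings D)) i) k
  | inr (i, k) => tnth (tnth (in_tuple (joints D)) i) k
  end.

Definition vertex (D : pd_code) (x : dart D) : (crossing D + joint D)%type :=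
  match x with inl (i, _) => inl i | inr (i, _) => inr i end.

(* The next dart counterclockwise around the vertex of x. *)
Definition node (D : pd_code) (x : dart D) : dart D :=
  match x with
  | inl (i, k) => inl (i, ordS k)
  | inr (i, k) => inr (i, ordS k)
  end.

(* The other half of the edge of x. *)
Definition edge (D : pd_code) (x : dart D) : dart D :=
  odflt x [pick y | (y != x) && (label y == label x)].

(* The orbits of face are the boundary walks of the faces. *)
Definition face (D : pd_code) : dart D -> dart D := @node D \o @edge D.

(* Euler's formula V - E + F = 2 C, where C is the number of connected components
   of the graph: each component is drawn on a sphere. The code does not
   record the relative position of distinct components; the link does not depend
   on it up to isotopy, being the split union of the links of these
   components. *)
Definition planar (D : pd_code) : bool :=
  let V := (size (crossings D) + size (joints D))%N in
  let E := #|dart D|./2 in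
  let F := fcard (@face D) (dart D) in
  let C := n_comp [rel x y : dart D | (label x == label y)
                                      || (vertex x == vertex y)] (dart D) in
  (V + F == E + C.*2)%N.

Record diagram := Diagram {
  code_of :> pd_code;
  _ : closed_code code_of && planar code_of }.

(** * Reidemeister moves and links *)

Definition relabel (a b : nat) (x : nat) : nat := if x == b then a else x.

(* Local replacements in a PD code, for non-oriented diagrams. The first four
   are mere changes of code. As each label of a diagram occurs
   exactly twice, the labels occurring twice in the displayed part of a code (such as e,
   o, u, x, y, z) occur nowhere else. *)
Inductive move : pd_code -> pd_code -> Prop :=
| move_perm cs cs' js js' :
    perm_eq cs cs' -> perm_eq js js' -> move (PD cs js) (PD cs' js')
| move_turn_crossing a b c d cs js :
    move (PD ([tuple a; b; c; d] :: cs) js) (PD ([tuple c; d; a; b] :: cs) js)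
| move_turn_joint a b cs js :
    move (PD cs ([tuple a; b] :: js)) (PD cs ([tuple b; a] :: js))
| move_joint a b cs js :
    a != b ->
    move (PD cs ([tuple a; b] :: js))
         (PD (map (map_tuple (relabel a b)) cs)
             (map (map_tuple (relabel a b)) js))
| move_R1 e a b cs js :
    move (PD ([tuple e; e; a; b] :: cs) js) (PD cs ([tuple a; b] :: js))
| move_R1' e a b cs js :
    move (PD ([tuple a; e; e; b] :: cs) js) (PD cs ([tuple a; b] :: js))
  (* The strand from p1 to q1 passes over the strand from p2 to q2, and back. *)
| move_R2 p1 q1 p2 q2 o u cs js :
    move (PD ([tuple p2; o; u; p1] :: [tuple u; o; q2; q1] :: cs) js)
         (PD cs ([tuple p1; q1] :: [tuple p2; q2] :: js))
  (* The strands run upwards from pi to qi, with p1, p2, p3 from left to right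
     and q1, q2, q3 from right to left. In move_R3 the strand i is
     above the strand j for i < j, and in move_R3' it is below. *)
| move_R3 p1 p2 p3 q1 q2 q3 x y z cs js :
    move (PD ([tuple p2; x; y; p1] :: [tuple p3; q1; z; x]
                :: [tuple z; q2; q3; y] :: cs) js)
         (PD ([tuple p3; y; z; p2] :: [tuple z; x; q3; p1]
                :: [tuple y; q1; q2; x] :: cs) js)
| move_R3' p1 p2 p3 q1 q2 q3 x y z cs js :
    move (PD ([tuple p1; p2; x; y] :: [tuple x; p3; q1; z]
                :: [tuple y; z; q2; q3] :: cs) js)
         (PD ([tuple p2; p3; y; z] :: [tuple p1; z; x; q3]
                :: [tuple x; y; q1; q2] :: cs) js).

(* All the intermediate codes are required to be diagrams. *)
Definition reidemeister : diagram -> diagram -> Prop :=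
  clos_refl_sym_trans diagram (fun D D' => move D D').

(* By Reidemeister's theorem, an isotopy class of links in S^3 is the same as the
   set of its diagrams, which is a class for the equivalence generated by the
   Reidemeister moves. *)
Record link := Link {
  diagram_of : set diagram;
  _ : exists D0, diagram_of = [set D | reidemeister D0 D] }.

(** * Arcs *)

(* Two darts are adjacent along an arc if they are the halves of an edge, or are the two
   over-darts of a crossing, or belong to the same joint. *)
Definition along (D : pd_code) : rel (dart D) := fun x y =>
  (label x == label y) ||
  match x, y with
  | inl (i, k), inl (j, l) => [&& i == j, odd k & odd l]
  | inr (i, _), inr (j, _) => i == j
  | _, _ => false
  end.

Definition darts_along (D : pd_code) (x : dart D) : {set dart D} :=
  [set y | connect (@along D) x y]%SET.

Definition arc_type (D : pd_code) : finType :=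
  {A : {set dart D} | A \in codom (@darts_along D)}.

Definition arc_of (D : pd_code) (x : dart D) : arc_type D :=
  Sub (darts_along x) (codom_f (@darts_along D) x).

Definition under_arc1 (D : pd_code) (i : crossing D) : arc_type D :=
  arc_of (inl (i, inord 0)).
Definition under_arc2 (D : pd_code) (i : crossing D) : arc_type D :=
  arc_of (inl (i, inord 2)).
(* Also arc_of (inl (i, inord 3)). *)
Definition over_arc (D : pd_code) (i : crossing D) : arc_type D :=
  arc_of (inl (i, inord 1)).

(** * Colorings *)

Definition n_coloring (n : nat) (D : pd_code) (g : arc_type D -> int) : Prop :=
  forall i : crossing D,
    (2 * g (over_arc i) = g (under_arc1 i) + g (under_arc2 i) %[mod n%:Z])%Z.

Definition trivial_coloring (D : pd_code) (g : arc_type D -> int) : Prop :=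
  forall a b, g a = g b.

Definition n_colorable (n : nat) (L : link) : Prop :=
  exists D : diagram, diagram_of L D /\
    exists g : arc_type D -> int, n_coloring n g /\ ~ trivial_coloring g.

Definition p_trivial (p : nat) (I : finType) (x : I -> int) : Prop :=
  forall i j, (x i = x j %[mod p%:Z])%Z.

Definition n_effective (n : nat) (I : finType) (x : I -> int) : Prop :=
  forall p, p \in primes n -> ~ p_trivial p x.

Definition effective_n_coloring (n : nat) (D : pd_code) (g : arc_type D -> int) :
    Prop :=
  [/\ n_coloring n g, ~ trivial_coloring g & n_effective n g].

Definition num_colors (D : pd_code) (g : arc_type D -> int) : nat :=
  size (undup (codom g)).

(* The minimum C*_n(L), which is +oo if L has no effectively n-colored diagram. *)
Definition Cstar (R : realType) (n : nat) (L : link) : \bar R :=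
  ereal_inf [set c | exists D : diagram, diagram_of L D /\
    exists g : arc_type D -> int,
      effective_n_coloring n g /\ c = ((num_colors g)%:R)%:E].

(** * Determinant *)

Definition coloring_mx (D : pd_code) :
    'M[int]_(size (crossings D), #|arc_type D|) :=
  \matrix_(i, j)
    (2 * (enum_val j == over_arc i)%:R
     - (enum_val j == under_arc1 i)%:R - (enum_val j == under_arc2 i)%:R).

(* d is the absolute value of a first minor of the coloring matrix of a diagram of L
   with as many arcs as crossings. The other diagrams of L are those with
   a component without under-crossings, and every nonempty link
   has a diagram without such components. *)
Definition first_minor_value (L : link) (d : nat) : Prop :=
  exists D : diagram, diagram_of L D /\
    exists (e : #|arc_type D| = size (crossings D)) (i j : 'I_(size (crossings D))),
      d = `|\det (row' i (col' j (castmx (erefl, e) (coloring_mx D))))|%N.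

(* The value does not depend on the diagram and on the minor, so that
   the choice made by xget is immaterial. *)
Definition link_det (L : link) : nat := xget 0%N (first_minor_value L).

Definition log2 (R : realType) (x : R) : R := ln x / ln 2.

(* Main.v *)
Require Import Defs.
From mathcomp Require Import perm all_boot all_order all_algebra.
From mathcomp Require Import all_classical all_reals all_analysis.
From mathcomp Require Import zify ring lra.

Set Implicit Arguments.
Unset Strict Implicit.
Unset Printing Implicit Defensive.

Import Order.TTheory GRing.Theory Num.Theory.

Local Open Scope ring_scope.

(** Call a diagram rigid if its only rational colorings are the constant ones.

   A nonzero first minor makes a diagram rigid ([rigid_minor]): the constant
   colorings are always solutions of the coloring equations, and after
   subtracting a constant, a coloring vanishes on any prescribed arc and is
   then annihilated by the minor. Rigidity is invariant under the Reidemeister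
   moves ([rigid_reidemeister]), because both sides of a move impose the same
   conditions on the colors of the ends, and the ends determine the colors
   inside. Thus all the diagrams of a link with
   nonzero determinant are rigid, including those whose first minors are not
   the determinant.

   Now let g be an effective n-coloring of a rigid diagram, with colors
   c_0, ..., c_m. Adding up the columns of the coloring matrix that belong to
   arcs of the same color, and deleting the column of c_0, gives a matrix M with
   m columns. A kernel vector of M is a rational coloring that only depends on
   the g-color of the arc and vanishes at c_0, so it is zero by rigidity. Hence
   M has a nonsingular square submatrix B of size m. Since g is a coloring, B
   sends the vector x of the c_j - c_0 to 0 modulo n. By Cramer's rule n divides
   each (det B) x_j, and as no prime factor of n divides all the x_j, n
   divides det B ([dvdn_jointly_coprime]).

   Finally |det B| <= 2 ^ m, which is sharper than Hadamard's inequality: a row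
   2 a - b - c is the sum of the rows a - b and a - c, so that det B is a sum of
   2 ^ m determinants of incidence matrices of directed graphs, and those lie in
   {-1, 0, 1} ([det_incidence_le1], [det_coloring_le]). Therefore
   n <= |det B| <= 2 ^ m. *)

(** * Determinants of matrices of coloring type *)

(** The value None stands for the deleted column, whose basis vector becomes
   zero. *)
Definition unit_entry (R : pzRingType) (m : nat) (a : option 'I_m) (j : 'I_m) : R :=
  (a == Some j)%:R.

Lemma sum_unit_entry (R : pzRingType) m (a : option 'I_m) (x : 'I_m -> R) :
  \sum_j unit_entry R a j * x j = oapp x 0 a.
Proof.
case: a => [i|]; last by rewrite big1 // => j _; rewrite mul0r.
rewrite (bigD1 i) //= /unit_entry eqxx mul1r big1 ?addr0 // => j ji.
by rewrite (inj_eq Some_inj) eq_sym (negPf ji) mul0r.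
Qed.

Lemma unit_entry_lift (R : pzRingType) m (a : option 'I_m.+1) (j0 : 'I_m.+1) (j : 'I_m) :
  unit_entry R a (lift j0 j) = unit_entry R (obind (unlift j0) a) j.
Proof.
rewrite /unit_entry; case: a => [a|] //=.
case: (unliftP j0 a) => [k ->|->].
  by rewrite !(inj_eq Some_inj) (inj_eq (@lift_inj _ _)).
by rewrite (inj_eq Some_inj) (negPf (neq_lift _ _)).
Qed.

Lemma det0_rowsum (R : idomainType) m (A : 'M[R]_m.+1) :
  (forall i, \sum_j A i j = 0) -> \det A = 0.
Proof.
move=> A0; rewrite -det_tr; apply/eqP/det0P; exists (const_mx 1).
  by apply/eqP => /rowP /(_ 0); rewrite !mxE; apply/eqP/oner_neq0.
apply/rowP => i; rewrite !mxE -[RHS](A0 i).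
by apply: eq_bigr => j _; rewrite !mxE mul1r.
Qed.

(** Total unimodularity of the incidence matrix of a directed graph with edges
   from t i to s i and with one vertex, None, deleted. If no edge meets None,
   all the row sums vanish. Otherwise the row of an edge meeting None has at
   most one nonzero entry, which is 1 or -1; expanding along it deletes an edge
   and merges a vertex with None, which leaves a matrix of the same form. *)
Lemma det_incidence_le1 m (s t : 'I_m -> option 'I_m) :
  `|\det (\matrix_(i, j) (unit_entry int (s i) j - unit_entry int (t i) j))| <= 1.
Proof.
elim: m s t => [|m IHm] s t; first by rewrite det_mx00.
set A := \matrix_(_, _) _.
have expand i j0 : (forall j, j != j0 -> A i j = 0) -> `|A i j0| <= 1 ->
  `|\det A| <= 1.
  move=> Ai0 Aij; rewrite (expand_det_row _ i) (bigD1 j0) //= big1 ?addr0.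
    rewrite normrM -[leRHS]mulr1 ler_pM //.
    rewrite /cofactor normrM normrX normrN1 expr1n mul1r.
    set B := row' _ _.
    pose r u k := obind (unlift j0) (u (lift i k) : option 'I_m.+1).
    rewrite (_ : B =
      \matrix_(k, j) (unit_entry int (r s k) j - unit_entry int (r t k) j)) //.
    by apply/matrixP => k j; rewrite !mxE !unit_entry_lift.
  by move=> j jj0; rewrite Ai0 // mul0r.
have [/existsP[i]|] := boolP [exists i, (s i == None) || (t i == None)].
  case si : (s i) => [a|]; case ti : (t i) => [b|] //= _.
  - apply: (expand i a) => [j ja|]; rewrite mxE si ti /unit_entry.
      by rewrite (inj_eq Some_inj) eq_sym (negPf ja) subrr.
    by rewrite eqxx.
  - apply: (expand i b) => [j ja|]; rewrite mxE si ti /unit_entry.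
      by rewrite (inj_eq Some_inj) (eq_sym b) (negPf ja) subrr.
    by rewrite eqxx.
  - by apply: (expand i 0) => [j _|]; rewrite mxE si ti.
rewrite negb_exists => /forallP st; rewrite det0_rowsum ?normr0 // => i.
have sum1 a : \sum_j unit_entry int (Some a : option 'I_m.+1) j = 1.
  have := sum_unit_entry (Some a) (fun=> 1 : int).
  by under eq_bigr do rewrite mulr1.
have := st i; case si : (s i) => [a|]; case ti : (t i) => [b|] //= _.
under eq_bigr do rewrite mxE si ti.
by rewrite sumrB !sum1 subrr.
Qed.

Lemma det_sum_rows (R : comPzRingType) m (U V : 'M[R]_m) :
  \det (U + V) =
  \sum_(f : {ffun 'I_m -> bool}) \det (\matrix_(i, j) (if f i then U else V) i j).
Proof.
rewrite /determinant exchange_big /=; apply: eq_bigr => s _.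
rewrite -mulr_sumr; congr (_ * _).
transitivity (\prod_i \sum_(b : bool) (if b then U else V) i (s i)).
  by apply: eq_bigr => i _; rewrite mxE big_bool.
rewrite bigA_distr_bigA; apply: eq_bigr => f _.
by apply: eq_bigr => i _; rewrite mxE.
Qed.

(** Splitting 2 a - b - c into (a - b) + (a - c) in each row expands the
   determinant into 2 ^ m determinants of incidence matrices. *)
Lemma det_coloring_le m (a b c : 'I_m -> option 'I_m) :
  `|\det (\matrix_(i, j) (2 * unit_entry int (a i) j
      - unit_entry int (b i) j - unit_entry int (c i) j))| <= 2 ^+ m.
Proof.
pose inc (t : 'I_m -> option 'I_m) : 'M[int]_m :=
  \matrix_(i, j) (unit_entry int (a i) j - unit_entry int (t i) j).
rewrite (_ : \matrix_(_, _) _ = inc b + inc c); last first.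
  by apply/matrixP => i j; rewrite !mxE; ring.
rewrite det_sum_rows (le_trans (ler_norm_sum _ _ _)) //.
have -> : 2 ^+ m = \sum_(f : {ffun 'I_m -> bool}) 1 :> int.
  by rewrite sumr_const card_ffun card_bool card_ord -natrX.
apply: ler_sum => f _.
rewrite (_ : \matrix_(_, _) _ = inc (fun i => if f i then b i else c i)).
  exact: det_incidence_le1.
by apply/matrixP => i j; rewrite !mxE; case: (f i); rewrite mxE.
Qed.

Lemma full_rank_minor m n (A : 'M[rat]_(m, n)) :
  (forall v : 'cV_n, A *m v = 0 -> v = 0) ->
  exists f : 'I_n -> 'I_m, rowsub f A \in unitmx.
Proof.
move=> A0; have rA : row_full A.
  rewrite -cokermx_eq0; apply/eqP/matrixP => i j.
  have /colP/(_ i) : col j (cokermx A) = 0.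
    by apply: A0; rewrite colE mulmxA mulmx_coker mul0mx.
  by rewrite !mxE.
by exists (fullrankfun rA); exact: fullrowsub_unit.
Qed.

(** * Arithmetic of congruences *)

(** For each prime p, some x i is prime to p, so the full power of p in n has to
   divide d. *)
Lemma dvdn_jointly_coprime (n d : nat) (I : Type) (x : I -> nat) : (0 < n)%N ->
  (forall i, n %| d * x i)%N ->
  (forall p, p \in primes n -> exists i, ~~ (p %| x i)%N) -> (n %| d)%N.
Proof.
move=> n_gt0 ndx npx; apply/(dvdn_partP _ n_gt0) => p pn.
have [i npxi] := npx p pn.
have p_pr : prime p by move: pn; rewrite mem_primes => /and3P[].
rewrite -(@Gauss_dvdl _ _ (x i)); last first.
  by rewrite p_part coprimeXl // prime_coprime.
exact: dvdn_trans (dvdn_part p n) (ndx i).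
Qed.

Lemma eqz_modP (n : nat) (x y : int) : (x = y %[mod n%:Z])%Z <-> (n %| `|x - y|)%N.
Proof.
rewrite -[(n %| _)%N]/(n%:Z %| x - y)%Z -eqz_mod_dvd.
exact: (rwP eqP).
Qed.

(** * Rational colorings of edge labels *)

(** Colorings of edges, rather than of arcs, have a type that does not
   depend on the diagram; they can therefore be compared across a move. *)
Definition crossing_rule (f : nat -> rat) (c : 4.-tuple nat) : bool :=
  (f (nth 0%N c 1) == f (nth 0%N c 3)) &&
  (2 * f (nth 0%N c 1) == f (nth 0%N c 0) + f (nth 0%N c 2)).

Definition joint_rule (f : nat -> rat) (j : 2.-tuple nat) : bool :=
  f (nth 0%N j 0) == f (nth 0%N j 1).

Definition label_coloring (f : nat -> rat) (D : pd_code) : bool :=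
  all (crossing_rule f) (crossings D) && all (joint_rule f) (joints D).

Definition constant_on (f : nat -> rat) (v : rat) (s : seq nat) : bool :=
  all (fun x => f x == v) s.

Definition rigid (D : pd_code) : Prop :=
  forall f, label_coloring f D -> exists v, constant_on f v (labels D).

(** A move replaces a tangle T in [glue T E] and keeps its exterior E. *)
Definition glue (T E : pd_code) : pd_code :=
  PD (crossings T ++ crossings E) (joints T ++ joints E).

Lemma perm_labels_glue T E :
  perm_eq (labels (glue T E)) (labels T ++ labels E).
Proof.
by rewrite /labels /= !map_cat !flatten_cat; apply/permP => P; rewrite !count_cat; lia.
Qed.

Lemma label_coloring_glue f T E :
  label_coloring f (glue T E) = label_coloring f T && label_coloring f E.
Proof. by rewrite /label_coloring /= !all_cat andbACA. Qed.

Lemma constant_on_glue f v T E :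
  constant_on f v (labels (glue T E)) =
  constant_on f v (labels T) && constant_on f v (labels E).
Proof. by rewrite /constant_on (perm_all _ (perm_labels_glue T E)) all_cat. Qed.

Lemma label_coloring_local f g D : {in labels D, f =1 g} ->
  label_coloring f D = label_coloring g D.
Proof.
move=> fg; rewrite /label_coloring; congr (_ && _).
  apply: eq_in_all => c cD.
  have E k : (k < 4)%N -> f (nth 0%N c k) = g (nth 0%N c k).
    move=> k4; apply: fg; rewrite mem_cat; apply/orP; left.
    by apply/flattenP; exists (val c); [exact: map_f | rewrite mem_nth ?size_tuple].
  by rewrite /crossing_rule !E.
apply: eq_in_all => c cD.
have E k : (k < 2)%N -> f (nth 0%N c k) = g (nth 0%N c k).
  move=> k2; apply: fg; rewrite mem_cat; apply/orP; right.
  by apply/flattenP; exists (val c); [exact: map_f | rewrite mem_nth ?size_tuple].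
by rewrite /joint_rule !E.
Qed.

(** * Invariance of rigidity under Reidemeister moves *)

(** As each label of a closed code occurs exactly twice, labels that are seen
   twice in a tangle occur nowhere else. *)
Lemma closed_fresh D (xs s : seq nat) : closed_code D ->
  perm_eq (labels D) (xs ++ xs ++ s) ->
  uniq xs /\ {in xs, forall x, x \notin s}.
Proof.
move=> /allP cD /permP pD.
have cnt x : x \in xs -> count_mem x xs = 1%N /\ count_mem x s = 0%N.
  move=> xxs; have c_gt0 : (0 < count_mem x xs)%N by rewrite -has_count has_pred1.
  have xD : x \in labels D.
    by rewrite -has_pred1 has_count pD !count_cat; lia.
  by have := pD (pred1 x); rewrite (eqP (cD x xD)) !count_cat; lia.
split; last by move=> x /cnt[_ /eqP]; rewrite -leqn0 leqNgt -has_count has_pred1.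
by apply: count_mem_uniq => x; have [/cnt[-> //]|/count_memPn ->] := boolP (x \in xs).
Qed.

Lemma extend_fresh (f : nat -> rat) (xs s : seq nat) (vs : seq rat) :
  uniq xs -> {in xs, forall x, x \notin s} -> size vs = size xs ->
  exists2 g, {in s, g =1 f} & map g xs = vs.
Proof.
move=> u_xs fresh sz.
exists (fun x => if x \in xs then nth 0 vs (index x xs) else f x).
  by move=> x xs'; case: ifP => // /fresh; rewrite xs'.
apply: (@eq_from_nth _ 0); rewrite size_map ?sz // => i ilt.
by rewrite (nth_map 0%N) // mem_nth // index_uniq.
Qed.

(** The form in which each move is checked. The labels xs are interior to the
   tangle T and the labels s are its ends. A coloring f of the new diagram
   is turned into one of the old diagram by giving new values vs to the interior
   labels; if the latter coloring is constant, f has to be constant on the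
   ends and then on all of T'. *)
Lemma rigid_replace T T' E (xs s : seq nat) :
  closed_code (glue T E) -> perm_eq (labels T) (xs ++ xs ++ s) ->
  (forall f, label_coloring f T' -> exists2 vs, size vs = size xs &
     forall g, map g s = map f s -> map g xs = vs -> label_coloring g T /\
       forall v, constant_on g v (labels T) -> constant_on f v (labels T')) ->
  rigid (glue T E) -> rigid (glue T' E).
Proof.
move=> cl pT H rT f; rewrite label_coloring_glue => /andP[fT' fE].
have [|u_xs fresh] := @closed_fresh _ xs (s ++ labels E) cl.
  apply: perm_trans (perm_labels_glue _ _) _.
  by rewrite (catA xs s) (catA xs (xs ++ s)) perm_cat2r.
have [vs sz {}H] := H f fT'.
have [g gf gv] := extend_fresh f u_xs fresh sz.
have [|gT gc] := H g _ gv.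
  by apply/eq_in_map => x xs'; rewrite gf // mem_cat xs'.
have gE : {in labels E, g =1 f} by move=> x xE; rewrite gf // mem_cat xE orbT.
have [|v] := rT g; first by rewrite label_coloring_glue gT (label_coloring_local gE).
rewrite constant_on_glue => /andP[/gc cT' cE].
exists v; rewrite constant_on_glue cT' /=.
by apply/allP => x xE; rewrite -gE //; exact: (allP cE).
Qed.

Lemma rigid_perm cs cs' js js' : perm_eq cs cs' -> perm_eq js js' ->
  rigid (PD cs js) -> rigid (PD cs' js').
Proof.
move=> pc pj rD f; rewrite /label_coloring /= -(perm_all _ pc) -(perm_all _ pj).
move=> /(rD f)[v cD]; exists v; move: cD.
rewrite /constant_on /labels /= !all_cat => /andP[cC cJ].
rewrite -(perm_all _ (perm_flatten (perm_map val pc))) cC.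
by rewrite -(perm_all _ (perm_flatten (perm_map val pj))) cJ.
Qed.

Lemma labels_relabel a b D :
  labels (PD (map (map_tuple (relabel a b)) (crossings D))
             (map (map_tuple (relabel a b)) (joints D))) =
  map (relabel a b) (labels D).
Proof. by rewrite /labels /= map_cat !map_flatten -!map_comp. Qed.

Lemma label_coloring_relabel f a b D :
  label_coloring f (PD (map (map_tuple (relabel a b)) (crossings D))
                       (map (map_tuple (relabel a b)) (joints D))) =
  label_coloring (f \o relabel a b) D.
Proof.
rewrite /label_coloring /= !all_map; congr (_ && _); apply: eq_all => t /=.
  by rewrite /crossing_rule /= !(nth_map 0%N) ?size_tuple.
by rewrite /joint_rule /= !(nth_map 0%N) ?size_tuple.
Qed.

(** Removing a joint identifies two labels all over the diagram, so that it
   is not the replacement of a tangle. *)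
Lemma rigid_joint a b cs js : a != b ->
  closed_code (PD cs ([tuple a; b] :: js)) ->
  rigid (PD cs ([tuple a; b] :: js)) <->
  rigid (PD (map (map_tuple (relabel a b)) cs)
            (map (map_tuple (relabel a b)) js)).
Proof.
move=> ab cl; pose E := PD cs js.
rewrite -[PD (map _ _) _]/(PD (map _ (crossings E)) (map _ (joints E))).
rewrite -[PD cs _]/(glue (PD [::] [:: [tuple a; b]]) E) in cl *.
split=> r f.
  rewrite label_coloring_relabel => fE.
  have [|v] := r (f \o relabel a b).
    rewrite label_coloring_glue fE andbT /label_coloring /joint_rule /relabel /=.
    by rewrite (negPf ab) eqxx eqxx.
  rewrite constant_on_glue => /andP[_ cE]; exists v.
  by rewrite labels_relabel /constant_on all_map.
rewrite label_coloring_glue => /andP[fT fE].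
have fab : f a = f b by case/andP: fT => _ /andP[/eqP].
have fr x : f (relabel a b x) = f x by rewrite /relabel; case: eqP => // ->.
have [|v] := r f.
  by rewrite label_coloring_relabel (@label_coloring_local _ f) // => x _ /=.
rewrite labels_relabel /constant_on all_map => cE.
have {}cE x : x \in labels E -> f x = v by move=> /(allP cE)/=; rewrite fr => /eqP.
(* The second occurrence of a is outside of the joint, because a != b. *)
have aE : a \in labels E.
  have pE := perm_labels_glue (PD [::] [:: [tuple a; b]]) E.
  have aT : a \in labels (glue (PD [::] [:: [tuple a; b]]) E).
    by rewrite (perm_mem pE) mem_head.
  move/permP/(_ (pred1 a)): pE; rewrite (eqP (allP cl a aT)).
  have ba : (b == a) = false by rewrite eq_sym (negPf ab).
  rewrite count_cat {1}/labels /= eqxx ba => ca.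
  by rewrite -has_pred1 has_count; case: count ca.
exists v; apply/allP => x; rewrite (perm_mem (perm_labels_glue _ _)) mem_cat.
case/orP => [|/cE ->//]; rewrite !inE => /orP[]/eqP->; first by rewrite cE.
by rewrite -fab cE.
Qed.

Ltac intro_coloring :=
  rewrite /label_coloring /crossing_rule /joint_rule /=;
  repeat match goal with
  | |- is_true (_ && _) -> _ => let H := fresh in case/andP => H; move: H
  | |- is_true (_ == _) -> _ => let H := fresh in move=> /eqP H
  | |- is_true true -> _ => move=> _
  end.

Ltac solve_local :=
  rewrite /label_coloring /constant_on /crossing_rule /joint_rule /=;
  repeat match goal with
  | |- _ /\ _ => split
  | |- forall v : rat, _ => intro
  | |- is_true (_ && _) -> _ => let H := fresh in case/andP => H; move: H
  | |- is_true (_ == _) -> _ => let H := fresh in move=> /eqP H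
  | |- is_true true -> _ => move=> _
  | |- is_true (_ && _) => apply/andP; split
  | |- is_true (_ == _) => apply/eqP
  | |- is_true true => done
  end; lra.

(** For each tangle, the values of the interior labels that are passed to
   [rigid_replace] are those that the crossing rules force from the ends: an
   over-strand keeps its value, and an under-strand of value w that passes below
   a strand of value v continues with value 2 v - w. The relations that follow
   between the ends are the same on both sides of the move. *)
Lemma rigid_move D D' : move D D' -> closed_code D -> closed_code D' ->
  rigid D <-> rigid D'.
Proof.
case=> {D D'}.
- move=> cs cs' js js' pc pj _ _.
  by split; apply: rigid_perm => //; rewrite perm_sym.
- move=> a b c d cs js cl cl'; split.
    apply: (@rigid_replace (PD [:: _] [::]) (PD [:: _] [::]) (PD cs js)
      [::] [:: a; b; c; d]) => //.
    by move=> f; intro_coloring; exists [::] => // g [? ? ? ?] _; solve_local.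
  apply: (@rigid_replace (PD [:: _] [::]) (PD [:: _] [::]) (PD cs js)
    [::] [:: c; d; a; b]) => //.
  by move=> f; intro_coloring; exists [::] => // g [? ? ? ?] _; solve_local.
- move=> a b cs js cl cl'; split.
    apply: (@rigid_replace (PD [::] [:: _]) (PD [::] [:: _]) (PD cs js)
      [::] [:: a; b]) => //.
    by move=> f; intro_coloring; exists [::] => // g [? ?] _; solve_local.
  apply: (@rigid_replace (PD [::] [:: _]) (PD [::] [:: _]) (PD cs js)
    [::] [:: b; a]) => //.
  by move=> f; intro_coloring; exists [::] => // g [? ?] _; solve_local.
- by move=> a b cs js ab cl _; exact: rigid_joint.
- move=> e a b cs js cl cl'; split.
    apply: (@rigid_replace (PD [:: _] [::]) (PD [::] [:: _]) (PD cs js)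
      [:: e] [:: a; b]) => //.
    by move=> f; intro_coloring; exists [:: f a] => // g [? ?] [?]; solve_local.
  apply: (@rigid_replace (PD [::] [:: _]) (PD [:: _] [::]) (PD cs js)
    [::] [:: a; b]) => //.
  by move=> f; intro_coloring; exists [::] => // g [? ?] _; solve_local.
- move=> e a b cs js cl cl'; split.
    apply: (@rigid_replace (PD [:: _] [::]) (PD [::] [:: _]) (PD cs js)
      [:: e] [:: a; b]) => //.
    + by apply/permP => P /=; ring.
    + by move=> f; intro_coloring; exists [:: f a] => // g [? ?] [?]; solve_local.
  apply: (@rigid_replace (PD [::] [:: _]) (PD [:: _] [::]) (PD cs js)
    [::] [:: a; b]) => //.
  by move=> f; intro_coloring; exists [::] => // g [? ?] _; solve_local.
- move=> p1 q1 p2 q2 o u cs js cl cl'; split.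
    apply: (@rigid_replace (PD [:: _; _] [::]) (PD [::] [:: _; _]) (PD cs js)
      [:: o; u] [:: p1; q1; p2; q2]) => //.
    + by apply/permP => P /=; ring.
    + move=> f; intro_coloring; exists [:: f p1; 2 * f p1 - f p2] => //.
      by move=> g [? ? ? ?] [? ?]; solve_local.
  apply: (@rigid_replace (PD [::] [:: _; _]) (PD [:: _; _] [::]) (PD cs js)
    [::] [:: p1; q1; p2; q2]) => //.
  by move=> f; intro_coloring; exists [::] => // g [? ? ? ?] _; solve_local.
- move=> p1 p2 p3 q1 q2 q3 x y z cs js cl cl'; split.
    apply: (@rigid_replace (PD [:: _; _; _] [::]) (PD [:: _; _; _] [::]) (PD cs js)
      [:: x; y; z] [:: p1; p2; p3; q1; q2; q3]) => //.
    + by apply/permP => P /=; ring.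
    + move=> f; intro_coloring.
      exists [:: f p1; 2 * f p1 - f p2; 2 * f p1 - f p3] => //.
      by move=> g [? ? ? ? ? ?] [? ? ?]; solve_local.
  apply: (@rigid_replace (PD [:: _; _; _] [::]) (PD [:: _; _; _] [::]) (PD cs js)
    [:: x; y; z] [:: p1; p2; p3; q1; q2; q3]) => //.
  + by apply/permP => P /=; ring.
  + move=> f; intro_coloring.
    exists [:: f p1; f p2; 2 * f p2 - f p3] => //.
    by move=> g [? ? ? ? ? ?] [? ? ?]; solve_local.
- move=> p1 p2 p3 q1 q2 q3 x y z cs js cl cl'; split.
    apply: (@rigid_replace (PD [:: _; _; _] [::]) (PD [:: _; _; _] [::]) (PD cs js)
      [:: x; y; z] [:: p1; p2; p3; q1; q2; q3]) => //.
    + by apply/permP => P /=; ring.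
    + move=> f; intro_coloring.
      exists [:: 2 * f p2 - f p1; f p2; f p3] => //.
      by move=> g [? ? ? ? ? ?] [? ? ?]; solve_local.
  apply: (@rigid_replace (PD [:: _; _; _] [::]) (PD [:: _; _; _] [::]) (PD cs js)
    [:: x; y; z] [:: p1; p2; p3; q1; q2; q3]) => //.
  + by apply/permP => P /=; ring.
  + move=> f; intro_coloring.
    exists [:: 2 * f p3 - f p1; 2 * f p3 - f p2; f p3] => //.
    by move=> g [? ? ? ? ? ?] [? ? ?]; solve_local.
Qed.

Lemma rigid_reidemeister (D D' : diagram) : reidemeister D D' -> rigid D <-> rigid D'.
Proof.
elim=> {D D'} [[D hD] [D' hD'] /= mv|D|D D' _ []|D1 D2 D3 _ [h12 h21] _ [h23 h32]];
  split; auto.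
- by case/andP: hD hD' => cD _ /andP[cD' _]; have [] := rigid_move mv cD cD'.
- by case/andP: hD hD' => cD _ /andP[cD' _]; have [] := rigid_move mv cD cD'.
Qed.

Lemma rigid_link L (D D' : diagram) :
  diagram_of L D -> diagram_of L D' -> rigid D -> rigid D'.
Proof.
case: L => S [D0 SE] /=; rewrite SE /= => mD mD' rD.
by apply/(rigid_reidemeister mD')/(rigid_reidemeister mD).
Qed.

(** * From edge labels to arcs *)

Definition arc_coloring (D : pd_code) (h : arc_type D -> rat) : Prop :=
  forall i, 2 * h (over_arc i) = h (under_arc1 i) + h (under_arc2 i).

Lemma arc_of_along D (x y : dart D) : along x y -> arc_of x = arc_of y.
Proof.
move=> xy; apply: val_inj; apply/setP => z; rewrite !inE.
apply: (same_connect _ (connect1 xy)); apply: sym_connect_sym => {z}.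
move=> [[i k]|[i k]] [[j l]|[j l]]; rewrite /along eq_sym; congr (_ || _) => //.
  by rewrite eq_sym (andbC (odd k)).
Qed.

Lemma arc_ofP D (a : arc_type D) : exists x, a = arc_of x.
Proof. by have /codomP[x ax] := valP a; exists x; apply: val_inj. Qed.

Lemma crossing_label_nth D (i : crossing D) k (k4 : (k < 4)%N) :
  nth 0%N (tnth (in_tuple (crossings D)) i) k = label (inl (i, inord k) : dart D).
Proof. by rewrite /= (tnth_nth 0%N) inordK. Qed.

Lemma joint_label_nth D (i : joint D) k (k2 : (k < 2)%N) :
  nth 0%N (tnth (in_tuple (joints D)) i) k = label (inr (i, inord k) : dart D).
Proof. by rewrite /= (tnth_nth 0%N) inordK. Qed.

Lemma mem_labels D l : reflect (exists x : dart D, label x = l) (l \in labels D).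
Proof.
rewrite mem_cat; apply: (iffP orP) => [[]|[[[i k]|[i k]] <-]].
- case/flattenP => _ /mapP[c /(tnthP (in_tuple _))[i ->] ->] /tnthP[k ->].
  by exists (inl (i, k)).
- case/flattenP => _ /mapP[c /(tnthP (in_tuple _))[i ->] ->] /tnthP[k ->].
  by exists (inr (i, k)).
- left; apply/flattenP; exists (val (tnth (in_tuple (crossings D)) i)).
    by apply: map_f; exact: (mem_tnth i (in_tuple _)).
  exact: mem_tnth.
- right; apply/flattenP; exists (val (tnth (in_tuple (joints D)) i)).
    by apply: map_f; exact: (mem_tnth i (in_tuple _)).
  exact: mem_tnth.
Qed.

Lemma label_coloringP f D : reflect
  ((forall i : crossing D,
      f (label (inl (i, inord 1) : dart D)) = f (label (inl (i, inord 3) : dart D)) /\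
      2 * f (label (inl (i, inord 1) : dart D)) =
      f (label (inl (i, inord 0) : dart D)) + f (label (inl (i, inord 2) : dart D))) /\
   (forall i : joint D,
      f (label (inr (i, inord 0) : dart D)) = f (label (inr (i, inord 1) : dart D))))
  (label_coloring f D).
Proof.
apply: (iffP andP) => [[/allP cD /allP jD]|[cD jD]]; split.
- move=> i; have /andP[/eqP + /eqP +] := cD _ (mem_tnth i (in_tuple _)).
  by rewrite !crossing_label_nth.
- by move=> i; have /eqP := jD _ (mem_tnth i (in_tuple _)); rewrite !joint_label_nth.
- apply/allP => _ /(tnthP (in_tuple _))[i ->].
  by have [c1 c2] := cD i; rewrite /crossing_rule !crossing_label_nth // c1 -c2 c1 !eqxx.
- apply/allP => _ /(tnthP (in_tuple _))[i ->].
  by rewrite /joint_rule !joint_label_nth // jD.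
Qed.

Lemma label_coloring_along f D (x y : dart D) : label_coloring f D ->
  along x y -> f (label x) = f (label y).
Proof.
move=> /label_coloringP[cD jD] /orP[/eqP-> //|].
have odd4 (i : crossing D) (k : 'I_4) : odd k ->
    f (label (inl (i, k) : dart D)) = f (label (inl (i, inord 1) : dart D)).
  move=> k_odd; have [c1 _] := cD i.
  suff [->|->] : k = inord 1 \/ k = inord 3 by [].
  by case: k k_odd => [[|[|[|[|]]]]] // k4 _; [left | right];
    apply: val_inj; rewrite /= inordK.
have joint2 (i : joint D) (k : 'I_2) :
    f (label (inr (i, k) : dart D)) = f (label (inr (i, inord 0) : dart D)).
  suff [->|->] : k = inord 0 \/ k = inord 1 by [].
  by case: k => [[|[|]]] // k2; [left | right]; apply: val_inj; rewrite /= inordK.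
case: x y => [[i k]|[i k]] [[j l]|[j l]] //.
  by case/and3P => /eqP<- ok ol; rewrite !odd4.
by move=> /eqP<-; rewrite !joint2.
Qed.

Lemma label_coloring_arc_of f D (x y : dart D) : label_coloring f D ->
  arc_of x = arc_of y -> f (label x) = f (label y).
Proof.
move=> fD /(congr1 val)/setP/(_ y); rewrite !inE connect0 => /connectP[p].
elim: p x => [|z p IHp] x /=; first by move=> _ ->.
by case/andP => /(label_coloring_along fD)-> ? ?; exact: IHp.
Qed.

(** The rules at the joints and over-strands say that a label coloring is
   constant along each arc, so that it is the same as a coloring of the arcs. *)
Lemma rigidP D : rigid D <->
  (forall h : arc_type D -> rat, arc_coloring h -> forall a b, h a = h b).
Proof.
split=> [rD h hD|rD f fD].
  (* The value 0 is only taken at labels that do not occur in D. *)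
  pose f l := if [pick x : dart D | label x == l] is Some x then h (arc_of x) else 0.
  have fl (x : dart D) : f (label x) = h (arc_of x).
    rewrite /f; case: pickP => [y yx|/(_ x)]; last by rewrite eqxx.
    by congr h; apply: arc_of_along; rewrite /along yx.
  have [|v /allP cv] := rD f.
    apply/label_coloringP; split=> i; rewrite !fl.
      split; last exact: hD.
      by congr h; apply: arc_of_along; rewrite /along eqxx !inordK ?orbT.
    by congr h; apply: arc_of_along; rewrite /along eqxx ?orbT.
  have hv a : h a = v.
    have [x ->] := arc_ofP a; rewrite -fl; apply/eqP/cv/mem_labels.
    by exists x.
  by move=> a b; rewrite !hv.
have rep (a : arc_type D) : {x : dart D | a == arc_of x}.
  by apply: sigW; have [x ->] := arc_ofP a; exists x.
pose h a := f (label (sval (rep a))).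
have hf x : h (arc_of x) = f (label x).
  by apply: label_coloring_arc_of => //; exact/esym/eqP/(svalP (rep _)).
have hc : arc_coloring h.
  by move=> i; rewrite !hf; have /label_coloringP[cD _] := fD; case: (cD i).
case lD : (labels D) => [|l s]; first by exists 0.
have /mem_labels[x xl] : l \in labels D by rewrite lD mem_head.
exists (f l); rewrite -lD; apply/allP => _ /mem_labels[y <-].
by rewrite -xl -!hf (rD h hc _ (arc_of x)).
Qed.

Lemma big_ord_lift (V : nmodType) n (j : 'I_n) (F : 'I_n -> V) :
  \sum_l F l = F j + \sum_k F (lift j k).
Proof. by case: n j F => [[] //|n] j F; rewrite (bigD1_ord j). Qed.

(** Subtracting its value at the arc of column j from a coloring gives a
   coloring that vanishes there; its other values form a vector in the kernel of
   the minor. *)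
Lemma rigid_minor D (e : #|arc_type D| = size (crossings D))
    (i j : 'I_(size (crossings D))) :
  \det (row' i (col' j (castmx (erefl, e) (coloring_mx D)))) != 0 -> rigid D.
Proof.
set B := row' _ _ => detB; apply/rigidP => h hD.
pose arc (k : 'I_(size (crossings D))) : arc_type D := enum_val (cast_ord (esym e) k).
have entry k l : (castmx (erefl, e) (coloring_mx D) k l)%:~R =
    2 * (arc l == over_arc k)%:R - (arc l == under_arc1 k)%:R
      - (arc l == under_arc2 k)%:R :> rat.
  by rewrite castmxE mxE /= cast_ord_id !rmorphB rmorphM /= !rmorph_nat.
pose g a := h a - h (arc j).
suff g0 c : g c = 0.
  by move=> a b; move: (g0 a) (g0 b); rewrite /g => /subr0_eq-> /subr0_eq->.
have arcK b : arc (cast_ord e (enum_rank b)) = b.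
  by rewrite /arc cast_ordK enum_rankK.
have gj : g (arc j) = 0 by rewrite /g subrr.
pose v : 'cV[rat]_(size (crossings D)).-1 := \col_l g (arc (lift j l)).
have arc_eq l b : (arc l == b) = (l == cast_ord e (enum_rank b)).
  by rewrite -{1}(arcK b) (inj_eq (inj_comp enum_val_inj (@cast_ord_inj _ _ _))).
have sum_arc b : \sum_l (arc l == b)%:R * g (arc l) = g b.
  rewrite (bigD1 (cast_ord e (enum_rank b))) //= arcK eqxx mul1r big1 ?addr0 // => l.
  by rewrite arc_eq => /negPf ->; rewrite mul0r.
have Bv : map_mx intr B *m v = 0.
  apply/colP => k; rewrite !mxE.
  transitivity
    (\sum_l (castmx (erefl, e) (coloring_mx D) (lift i k) l)%:~R * g (arc l)).
    rewrite (big_ord_lift j) gj mulr0 add0r.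
    by apply: eq_bigr => l _; rewrite !mxE.
  under eq_bigr do rewrite entry !mulrBl -mulrA.
  by rewrite !sumrB -mulr_sumr !sum_arc /g mulrBr hD; ring.
have v0 : v = 0.
  have uB : (map_mx intr B : 'M[rat]_((size (crossings D)).-1)) \in unitmx.
    by rewrite unitmxE det_map_mx unitfE intr_eq0.
  by rewrite -(mulKmx uB v) Bv mulmx0.
rewrite -[c]arcK; case: (unliftP j (cast_ord e (enum_rank c))) => [l ->|-> //].
by move/colP/(_ l): v0; rewrite !mxE.
Qed.

(** * The bound *)

(** The color c_0 is the deleted column: [color] sends the arcs of color c_0 to
   None and those of color s`_j to Some j. The proof follows the argument for
   M, B and x given at the top. *)
Theorem num_colors_lower_bound n (D : pd_code) (g : arc_type D -> int) :
  (0 < n)%N -> rigid D -> effective_n_coloring n g ->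
  (n <= 2 ^ (num_colors g).-1)%N /\ (0 < num_colors g)%N.
Proof.
move=> n_gt0 /rigidP rD [gc gnt ge]; rewrite /num_colors.
have mem_color a : g a \in undup (codom g) by rewrite mem_undup codom_f.
have color_arc x : x \in undup (codom g) -> exists a, g a = x.
  by rewrite mem_undup => /codomP[a ->]; exists a.
have : uniq (undup (codom g)) by exact: undup_uniq.
case: (undup (codom g)) mem_color color_arc => [|c0 s] mem_color color_arc /=.
  by case: gnt => a; have := mem_color a.
case/andP=> c0s us; split=> //.
set m := size s.
pose x (j : 'I_m) : int := s`_j - c0.
pose color a : option 'I_m := insub (index (g a) s).
have color_nth a j : color a = Some j -> g a = s`_j.
  rewrite /color; case: insubP => // k kl kE [<-].
  by rewrite kE nth_index // -index_mem.
have color_None a : color a = None -> g a = c0.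
  rewrite /color; case: insubP => // + _; rewrite index_mem => gas.
  by have := mem_color a; rewrite inE (negPf gas) orbF => /eqP.
have color0 a : g a = c0 -> color a = None.
  by move=> gac; apply: insubF; rewrite index_mem gac (negPf c0s).
have colorS a (j : 'I_m) : g a = s`_j -> color a = Some j.
  by move=> gac; rewrite /color gac index_uniq // valK.
have colorE a : oapp x 0 (color a) = g a - c0.
  case ca : (color a) => [j|] /=; first by rewrite /x (color_nth _ _ ca).
  by rewrite (color_None _ ca) subrr.
pose M := \matrix_(i < size (crossings D), j < m)
   (2 * unit_entry int (color (over_arc i)) j
    - unit_entry int (color (under_arc1 i)) j
    - unit_entry int (color (under_arc2 i)) j).
have Mw (w : 'I_m -> rat) i : \sum_j (M i j)%:~R * w j =
   2 * oapp w 0 (color (over_arc i)) - oapp w 0 (color (under_arc1 i))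
    - oapp w 0 (color (under_arc2 i)).
  under eq_bigr do
    rewrite mxE !rmorphB rmorphM /= /unit_entry !rmorph_nat !mulrBl -mulrA.
  by rewrite !sumrB -mulr_sumr !sum_unit_entry.
have Mx i : (n %| `|(\sum_j M i j * x j)%R|)%N.
  have -> : \sum_j M i j * x j =
      2 * g (over_arc i) - (g (under_arc1 i) + g (under_arc2 i)).
    under eq_bigr do rewrite mxE !mulrBl -mulrA.
    by rewrite !sumrB -mulr_sumr !sum_unit_entry !colorE; ring.
  by apply/eqz_modP; exact: gc.
have [f uf] : exists f, rowsub f (map_mx intr M : 'M[rat]_(_, _)) \in unitmx.
  apply: full_rank_minor => v Mv0.
  have hc : arc_coloring (fun a => oapp (v^~ 0) 0 (color a)).
    move=> i; move/colP/(_ i): Mv0; rewrite !mxE.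
    under eq_bigr do rewrite mxE.
    by rewrite Mw; lra.
  apply/colP => j; rewrite mxE.
  have [a ga] := color_arc s`_j ltac:(by rewrite inE mem_nth ?orbT).
  have [b gb] := color_arc c0 ltac:(by rewrite inE eqxx).
  by have /= := rD _ hc a b; rewrite (colorS _ _ ga) (color0 _ gb).
pose B := rowsub f M.
have detB : \det B != 0.
  by move: uf; rewrite -map_mxsub unitmxE det_map_mx unitfE intr_eq0.
have ndB : (n %| `|\det B|)%N.
  apply: (@dvdn_jointly_coprime n _ _ (fun j => `|x j|%N)) => // [j|p pn].
    have : \adj B *m (B *m \col_j x j) = \det B *: \col_j x j.
      by rewrite mulmxA mul_adj_mx mul_scalar_mx.
    move/colP/(_ j); rewrite !mxE -abszM => <-.
    rewrite -[n]/(absz n%:Z) -dvdzE rpred_sum // => k _.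
    rewrite dvdz_mull // mxE dvdzE.
    rewrite (_ : \sum_l _ = \sum_l M (f k) l * x l); first exact: Mx.
    by apply: eq_bigr => l _; rewrite /B /M !mxE.
  have [/existsP //|] := boolP [exists j, ~~ (p %| `|x j|)%N].
  rewrite negb_exists => /forallP npx; case: (ge p pn) => a b; apply/eqz_modP.
  have pc c : (p%:Z %| g c - c0)%Z.
    rewrite -colorE; case: (color c) => [j|] /=; last exact: dvdz0.
    by have := npx j; rewrite negbK dvdzE.
  by have := rpredB (pc a) (pc b); rewrite dvdzE opprB addrA subrK.
have := det_coloring_le (color \o over_arc (D:=D) \o f)
  (color \o under_arc1 (D:=D) \o f) (color \o under_arc2 (D:=D) \o f).
rewrite (_ : \matrix_(_, _) _ = B); last by apply/matrixP => i j; rewrite !mxE.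
move=> detB_le; apply: (@leq_trans `|\det B|%N).
  by rewrite dvdn_leq // absz_gt0.
by rewrite -lez_nat abszE (le_trans detB_le) // -natz natrX.
Qed.

Theorem theorem1p1 (R : realType) (n : nat) (hn : (0 < n)%N) (L : link)
    (hcol : n_colorable n L) (hdet : link_det L <> 0%N) :
  ((1 + log2 (n%:R : R))%R%:E <= Cstar R n L)%E.
Proof.
(* As the default value of xget is 0, a nonzero link_det is a minor of some
   diagram. *)
have [d [D0 [LD0 [e [i [j dE]]]]] d_neq0] : exists2 d, first_minor_value L d & d <> 0%N.
  have [exd|nex] := pselect (exists d, first_minor_value L d).
    by exists (link_det L) => //; exact: xgetPex.
  by case: hdet; rewrite /link_det xgetPN // => d dL; apply: nex; exists d.
have rD0 : rigid D0.
  by apply: (rigid_minor (e := e) (i := i) (j := j)); rewrite -absz_eq0 -dE; exact/eqP.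
apply/ereal_infP => _ [D [LD [g [gn ->]]]].
have rD := rigid_link LD0 LD rD0.
have [n_le k_gt0] := num_colors_lower_bound hn rD gn.
rewrite lee_fin -(prednK k_gt0) -natr1 addrC lerD2r /log2.
have ln2 : 0 < ln 2 :> R by rewrite ln_gt0 ?ltr1n.
rewrite ler_pdivrMr // mulr_natl -lnXn //.
by rewrite ler_ln ?posrE ?ltr0n ?exprn_gt0 // -natrX ler_nat.
Qed.
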